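(* For every $\epsilon>0$ there is a constant $c>0$ such that for every integral domain $D$ of characteristic zero and every finite subset $A\subset D$, $$c\,|A|^{14/13-\epsilon}\le\max\{|A+A|,|AA|\}.$$
   Context: $A+A:=\{a_1+a_2: a_1,a_2\in A\}$ and $AA:=\{a_1a_2: a_1,a_2\in A\}$. *)

(* Defs.v *)
From mathcomp Require Import all_boot all_algebra.
From Stdlib Require Import Reals.
Set Implicit Arguments. Unset Strict Implicit. Unset Printing Implicit Defensive.
Import GRing.Theory.
Local Open Scope ring_scope.

(* A finite subset of D is represented by a sequence; its cardinality is the
   number of distinct elements. *)
Definition card_seq (T : eqType) (s : seq T) : nat := size (undup s).

(* A + A and AA, as sequences (duplicates irrelevant since we count with undup) *)
Definition sumset (D : nzRingType) (A : seq D) : seq D :=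
  [seq a1 + a2 | a1 <- A, a2 <- A].
Definition prodset (D : nzRingType) (A : seq D) : seq D :=
  [seq a1 * a2 | a1 <- A, a2 <- A].

Definition char_zero (D : nzRingType) : Prop := [pchar D] =i pred0.

(* Main.v *)
Require Import Defs.
From mathcomp Require Import all_boot all_order all_algebra finmap zify ring.

(** The proof is that of Katz and Shen, run directly in [D].  Let [n = |A|],
    [M = |A + A|], [Q = |AA|].  By Cauchy-Schwarz some [b] in [A] has
    [sum_a |aA ∩ bA| >= n^3 / Q].  Let [A1] be the set of [a] with
    [|aA ∩ bA| >= N].  In characteristic zero there are [a, b', c, d] in [A1]
    such that [(x, y) |-> (c - d) x + ((a - b') + (c - d)) y] is injective on
    [A1 * A1]; Plünnecke's inequality then bounds [|A1|^3], up to constants, by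
    [M |cA2 - dA2 + aA2 - b'A2|] for a large [A2] included in [A1].  As
    [xA1 + (xA ∩ bA)] lies in [x(A + A)] for [x] in [A1], most of [xA1] is
    covered by [O(M / N)] translates of [bA] or of [-bA], so this is at most
    [M (M / N)^4 |2A - 2A|], i.e. [n^3 |A1|^3 N^4 = O(M^9)].  Summing over the
    levels [N] gives [n^14 = O(M^9 Q^4)], which is even the exponent 14/13
    without loss. *)

Set Implicit Arguments.
Unset Strict Implicit.
Unset Printing Implicit Defensive.
Import Order.TTheory GRing.Theory Num.Theory.

Local Open Scope fset_scope.
Local Open Scope nat_scope.

(** * Counting, averaging and level sets over finite sets *)

Lemma card_fsetM (T1 T2 : choiceType) (A : {fset T1}) (B : {fset T2}) :
  #|` A `*` B| = #|` A| * #|` B|.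
Proof.
rewrite (perm_size (enum_imfset2 _ _)) /=; last first.
  by move=> [x y] [x' y'] _ _ /= [-> ->].
by rewrite size_allpairs.
Qed.

Lemma leq_card_fset_surj (T1 T2 T : choiceType) (f : T1 -> T2 -> T)
    (A : {fset T1}) (B : {fset T2}) (C : {fset T}) :
  (forall z, z \in C -> exists2 x, x \in A & exists2 y, y \in B & z = f x y) ->
  #|` C| <= #|` A| * #|` B|.
Proof.
move=> fC; rewrite -card_fsetM.
have := leq_imfset_card imfset_key (fun p : T1 * T2 => f p.1 p.2) (mem (A `*` B)).
apply: leq_trans; apply/fsubset_leq_card/fsubsetP => z /fC[x xA [y yB ->]].
by apply/imfsetP; exists (x, y) => //=; rewrite in_fsetM /= xA.
Qed.

Lemma leq_card_fset_inj (T1 T2 T : choiceType) (f : T1 -> T2 -> T)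
    (A : {fset T1}) (B : {fset T2}) (C : {fset T}) :
  (forall x y, x \in A -> y \in B -> f x y \in C) ->
  (forall x y x' y', x \in A -> y \in B -> x' \in A -> y' \in B ->
     f x y = f x' y' -> x = x' /\ y = y') ->
  #|` A| * #|` B| <= #|` C|.
Proof.
move=> fC finj; rewrite -card_fsetM.
pose g (p : T1 * T2) := f p.1 p.2.
have <- : #|` imfset imfset_key g (mem (A `*` B))| = #|` A `*` B|.
  rewrite card_in_imfset // => -[x y] [x' y'].
  rewrite !inE /= => /andP[xA yB] /andP[xA' yB'] e.
  by have [-> ->] := finj _ _ _ _ xA yB xA' yB' e.
apply/fsubset_leq_card/fsubsetP => z /imfsetP[[x y]].
by rewrite inE /= => /andP[xA yB] ->; apply: fC.
Qed.

Lemma exists_ge_average (T : eqType) (s : seq T) (f : T -> nat) :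
  0 < size s ->
  exists2 x, x \in s & \sum_(y <- s) f y <= size s * f x.
Proof.
elim: s => [//|a [|b s] IH] _.
  by exists a; rewrite ?mem_head // big_seq1 mul1n.
have [//|x xs lex] := IH; rewrite big_cons.
have [le_ax|le_xa] := leqP (f a) (f x).
  exists x; first by rewrite inE xs orbT.
  by rewrite [size _]/= mulSn leq_add.
exists a; first exact: mem_head.
by rewrite mulSn leq_add2l (leq_trans lex) // leq_mul2l ltnW ?orbT.
Qed.

Lemma sqr_sum_leq (T : Type) (s : seq T) (f : T -> nat) :
  (\sum_(x <- s) f x) ^ 2 <= size s * \sum_(x <- s) f x ^ 2.
Proof.
rewrite -(leq_pmul2l (ltn0Sn 1)) expnS expn1 big_distrl big_distrr /=.
have -> : 2 * (size s * \sum_(x <- s) f x ^ 2)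
   = \sum_(x <- s) \sum_(y <- s) (f x ^ 2 + f y ^ 2).
  under [RHS]eq_bigr => x _ do
    rewrite big_split /= big_const_seq count_predT iter_addn_0.
  rewrite big_split /= -big_distrl /= big_const_seq count_predT iter_addn_0.
  by rewrite (mulnC (size s)) mul2n addnn.
apply: leq_sum => x _; rewrite big_distrr big_distrr /=.
by apply: leq_sum => y _; apply: nat_Cauchy.
Qed.

(* With [S] the sum, [w] the smallest of [u] values: if [S <= 4uw] the bound on
   [w] suffices; otherwise [(1 - 1/(4u))^4 >= 1 - 1/u] lets the induction go on. *)
Lemma quartic_step (u w s M : nat) : u.+1 ^ 3 * w ^ 4 <= M ->
  s ^ 4 <= 256 * M * u -> (s + w) ^ 4 <= 256 * M * u.+1.
Proof.
move=> hw hs; have [le_S|lt_S] := leqP (s + w) (4 * u.+1 * w).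
  apply: (@leq_trans ((4 * u.+1 * w) ^ 4)); first by rewrite leq_exp2r.
  suff -> : (4 * u.+1 * w) ^ 4 = 256 * (u.+1 ^ 3 * w ^ 4) * u.+1.
    by rewrite leq_mul2r leq_mul2l hw orbT.
  by rewrite !expnS; ring.
case: u => [|u] in hw hs lt_S *.
  have s0 : s = 0 by case: s hs {lt_S} => // s; rewrite muln0 leqn0 expn_eq0.
  by move: lt_S; rewrite s0 add0n muln1 ltnNge leq_pmull.
set S := s + w in lt_S *; set v := u.+2 in hw lt_S *.
have h1 : ((4 * v - 1) * S) ^ 4 <= (4 * v * s) ^ 4.
  by rewrite leq_exp2r // mulnBl mul1n leq_subLR /S mulnDr addnC leq_add2r ltnW.
have h2 : (4 * v) ^ 3 * (4 * v - 4) <= (4 * v - 1) ^ 4.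
  have -> : 4 * v = 4 * u + 4 + 4 by rewrite /v !mulnS !(addnC 4).
  rewrite addnK -addnBA // (_ : 4 - 1 = 3) //.
  move: (4 * u + 4) => x.
  suff -> : (x + 3) ^ 4 = (x + 4) ^ 3 * x + (6 * x ^ 2 + 44 * x + 81).
    exact: leq_addr.
  by rewrite !expnS; ring.
have hv : 4 * v - 4 = 4 * u.+1 by rewrite /v mulnS addKn.
have v0 : 0 < v by [].
clearbody S v.
have h3 : u.+1 * S ^ 4 <= v * s ^ 4.
  have : (4 * v) ^ 3 * (4 * v - 4) * S ^ 4 <= (4 * v * s) ^ 4.
    by apply: leq_trans h1; rewrite [X in _ <= X]expnMn leq_mul2r h2 orbT.
  rewrite hv.
  have -> : (4 * v * s) ^ 4 = (256 * v ^ 3) * (v * s ^ 4) by rewrite !expnS; ring.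
  have -> : (4 * v) ^ 3 * (4 * u.+1) * S ^ 4 = (256 * v ^ 3) * (u.+1 * S ^ 4).
    by rewrite !expnS; ring.
  by rewrite leq_pmul2l // muln_gt0 expn_gt0 v0.
rewrite -(leq_pmul2l (ltn0Sn u)); apply: leq_trans h3 _.
by rewrite [X in _ <= X]mulnA [X in _ <= X]mulnC leq_mul2l (mulnC u.+1) hs orbT.
Qed.

(** The hypothesis makes the [i]-th largest weight at most [(M / i^3)^(1/4)], and the sum of
    [i^(-3/4)] over [i <= n] is at most [4 n^(1/4)], whence [256 = 4^4]. The induction removes an
    element of least weight [w]: the level set at [w] is all of [A], so [|A|^3 w^4 <= M], as
    [quartic_step] requires. *)
Lemma sum_leq_of_levels (T : choiceType) (A : {fset T}) (w : T -> nat) (M : nat) :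
  (forall t, #|` [fset x in A | t <= w x]| ^ 3 * t ^ 4 <= M) ->
  (\sum_(x <- A) w x) ^ 4 <= 256 * M * #|` A|.
Proof.
move: {2}#|` A| (erefl #|` A|) => n; elim: n A => [|n IH] A cA hA.
  by rewrite (cardfs0_eq cA) big_seq_fset0.
have [x0 x0A] : exists x, x \in A by apply/fset0Pn; rewrite -cardfs_gt0 cA.
case: (@arg_minnP _ [` x0A] xpredT (fun i => w (val i)) isT) => i _ imin.
have iA : val i \in A by apply: valP.
rewrite (big_fsetD1 _ iA) /= addnC cA; have cD : #|` A `\ val i| = n.
  by move: cA; rewrite (cardfsD1 (val i)) iA => -[].
apply: quartic_step.
  rewrite -cA; apply: leq_trans (hA (w (val i))). rewrite leq_mul2r.
  apply/orP; right; rewrite leq_exp2r //; apply/fsubset_leq_card/fsubsetP => x xA.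
  by rewrite !inE xA; apply: (imin [` xA]).
rewrite -cD; apply: IH => // t; apply: leq_trans (hA t); rewrite leq_mul2r.
apply/orP; right; rewrite leq_exp2r //; apply/fsubset_leq_card/fsubsetP => x.
by rewrite !inE /= => /andP[/andP[_ ->] ->].
Qed.

(** * Sumsets in abelian groups: Plünnecke, Ruzsa and covering *)

Section Additive.
Variable V : zmodType.
Implicit Types (A B C D U S T W X Y Z : {fset V}) (d : V).

Definition addfs A B : {fset V} := [fset (a + b)%R | a in A, b in B].
Definition shiftfs d A : {fset V} := [fset (a + d)%R | a in A].

Lemma addfsP A B z :
  reflect (exists2 a, a \in A & exists2 b, b \in B & z = (a + b)%R)
          (z \in addfs A B).
Proof. exact: imfset2P. Qed.

Lemma mem_addfs A B a b : a \in A -> b \in B -> (a + b)%R \in addfs A B.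
Proof. by move=> aA bB; apply/addfsP; exists a => //; exists b. Qed.

Lemma mem_shiftfs A d a : (a \in shiftfs d A) = ((a - d)%R \in A).
Proof.
apply/imfsetP/idP => [[x /= xA ->]|adA]; first by rewrite addrK.
by exists (a - d)%R => //; rewrite subrK.
Qed.

Lemma card_shiftfs d A : #|` shiftfs d A| = #|` A|.
Proof. by rewrite card_imfset //; apply: addIr. Qed.

Lemma addfsS A A' B B' : A `<=` A' -> B `<=` B' -> addfs A B `<=` addfs A' B'.
Proof.
move=> /fsubsetP AA' /fsubsetP BB'; apply/fsubsetP => _ /addfsP[a aA [b bB ->]].
by rewrite mem_addfs ?AA' ?BB'.
Qed.

Lemma card_addfs_l A B : B != fset0 -> #|` A| <= #|` addfs A B|.
Proof.
case/fset0Pn => b bB; rewrite -(card_shiftfs b); apply: fsubset_leq_card.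
by apply/fsubsetP => _ /imfsetP[a /= aA ->]; apply: mem_addfs.
Qed.

Lemma addfs0 A : addfs A fset0 = fset0.
Proof.
apply/fsetP => z; rewrite in_fset0; apply/negP => /addfsP[a _ [b]].
by rewrite in_fset0.
Qed.

Lemma addfs_1U X d D : addfs X (d |` D) = addfs X D `|` shiftfs d X.
Proof.
apply/fsetP => z; rewrite in_fsetU mem_shiftfs; apply/idP/orP.
  case/addfsP => x xX [y]; rewrite in_fset1U => /orP[/eqP->|yD] ->.
    by right; rewrite addrK.
  by left; apply: mem_addfs.
case=> [/addfsP[x xX [y yD ->]]|zX].
  by rewrite mem_addfs // in_fset1U yD orbT.
by rewrite -[z](subrK d) mem_addfs // in_fset1U eqxx.
Qed.

Lemma addfsA A B C : addfs (addfs A B) C = addfs A (addfs B C).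
Proof.
apply/fsetP => z; apply/addfsP/addfsP.
  case=> _ /addfsP[a aA [b bB ->]] [c cC ->]; exists a => //.
  by exists (b + c)%R; [exact: mem_addfs | rewrite addrA].
case=> a aA [_ /addfsP[b bB [c cC ->]] ->]; exists (a + b)%R; first exact: mem_addfs.
by exists c => //; rewrite addrA.
Qed.

Lemma addfsC A B : addfs A B = addfs B A.
Proof.
by apply/fsetP => z; apply/addfsP/addfsP => -[a aA [b bB ->]];
   exists b => //; exists a => //; rewrite addrC.
Qed.

(** Submodularity of [|. + B|]: the union adds up to the union of [W + B] and [X + B + d], while the
    overlap of [W] and [X + d] adds up to a subset of their intersection. *)
Lemma card_addfs_submod B W X d :
  #|` addfs (W `|` shiftfs d X) B| + #|` addfs [fset x in X | (x + d)%R \in W] B|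
    <= #|` addfs W B| + #|` addfs X B|.
Proof.
rewrite -(card_shiftfs d (addfs X B)) -[X in _ <= X]cardfsUI leq_add //.
  apply/fsubset_leq_card/fsubsetP => z /addfsP[x xWX [b bB ->]]; move: xWX.
  rewrite !in_fsetU !mem_shiftfs => /orP[xW|xX]; apply/orP.
    by left; apply: mem_addfs.
  by right; rewrite addrAC mem_addfs.
rewrite -(card_shiftfs d); apply/fsubset_leq_card/fsubsetP => z.
rewrite mem_shiftfs => /addfsP[x]; rewrite !inE mem_shiftfs /= => /andP[xX xW] [b bB zE].
by rewrite zE mem_addfs // andbT -[z](subrK d) zE addrAC mem_addfs.
Qed.

Lemma card_setU_shiftfs W X d :
  #|` W `|` shiftfs d X| + #|` [fset x in X | (x + d)%R \in W]| = #|` W| + #|` X|.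
Proof.
rewrite -(card_shiftfs d X) -[RHS]cardfsUI; congr (_ + _).
rewrite -(card_shiftfs d); congr #|` _|; apply/fsetP => z.
by rewrite in_fsetI !mem_shiftfs !inE /= subrK andbC.
Qed.

(** Petridis's argument for any submodular [f], so that it also applies to a weighted sum of two
    expansions. Adjoining [d] to [D] adds [X + d], whose overlap with [W] is a translate of some [Y]
    inside [X]; submodularity saves [f Y], and minimality of the ratio at [X] makes this saving at
    least [f X * |Y| / |X|]. *)
Lemma petridis (f : {fset V} -> nat) X :
    f fset0 = 0 ->
    (forall W d, f (W `|` shiftfs d X) + f [fset x in X | (x + d)%R \in W]
                   <= f W + f X) ->
    (forall Y, Y `<=` X -> f X * #|` Y| <= f Y * #|` X|) ->
  forall D, f (addfs X D) * #|` X| <= f X * #|` addfs X D|.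
Proof.
move=> f0 fsub fmin; apply: fset1U_rect => [|d D _ IH].
  by rewrite addfs0 f0.
rewrite addfs_1U; set W := addfs X D in IH *.
have := fsub W d; have := card_setU_shiftfs W X d.
have : [fset x in X | (x + d)%R \in W] `<=` X.
  by apply/fsubsetP => x; rewrite !inE => /andP[].
move/fmin; move: (f [fset _ in _ | _]) #|` [fset _ in _ | _]| => fY cY.
move: (f (W `|` _)) #|` W `|` _| => fn cn hmin hc hf.
have hf' : (fn + fY) * #|` X| <= (f W + f X) * #|` X| by rewrite leq_mul2r hf orbT.
rewrite -(leq_add2r (fY * #|` X|)) -mulnDl (leq_trans hf') //.
rewrite mulnDl (leq_trans (leq_add IH (leqnn _))) // -mulnDr -hc mulnDr.
by rewrite leq_add2l.
Qed.

Lemma exists_min_ratio (f : {fset V} -> nat) Z : Z != fset0 ->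
  exists X, [/\ X `<=` Z, X != fset0
    & forall Y, Y `<=` Z -> f X * #|` Y| <= f Y * #|` X|].
Proof.
move=> Z0.
have ZP : Z \in fpowerset Z by rewrite fpowersetE.
pose F (X : fpowerset Z) : rat := ((f (val X))%:R / (#|` val X|)%:R)%R.
pose P : {pred fpowerset Z} := fun X : fpowerset Z => (val X : {fset V}) != fset0.
case: (@Order.TotalTheory.arg_minP _ _ _ [` ZP] P F Z0) => X X0 Xmin.
exists (val X); split=> //; first by rewrite -fpowersetE (valP X).
move=> Y YZ; have [->|Y0] := eqVneq Y fset0; first by rewrite cardfs0 muln0.
have YP : Y \in fpowerset Z by rewrite fpowersetE.
have := Xmin [` YP] Y0; rewrite /F /=.
rewrite ler_pdivrMr ?ltr0n ?cardfs_gt0 // mulrAC ler_pdivlMr ?ltr0n ?cardfs_gt0 //.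
by rewrite -!natrM ler_nat.
Qed.

(* Minimising the two expansion ratios jointly keeps [X] small for both
   summands at once. *)
Lemma plunnecke2 Z B C : Z != fset0 ->
  exists X, [/\ X `<=` Z, X != fset0 &
    #|` addfs (addfs X C) B| * #|` Z| ^ 2
      <= 4 * #|` addfs Z B| * #|` addfs Z C| * #|` X|].
Proof.
move=> Z0; have [->|C0] := eqVneq C fset0.
  exists Z; split=> //; rewrite addfs0; suff -> : addfs fset0 B = fset0 by [].
  by rewrite addfsC addfs0.
have [->|B0] := eqVneq B fset0; first by exists Z; split=> //; rewrite addfs0.
set p := #|` addfs Z C|; set q := #|` addfs Z B|.
have p0 : 0 < p by apply: leq_trans (card_addfs_l Z C0); rewrite cardfs_gt0.
have q0 : 0 < q by apply: leq_trans (card_addfs_l Z B0); rewrite cardfs_gt0.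
(* These weights make both terms equal to [p * q] at [Z], so a minimiser has
   [f X / |X| <= 2pq / |Z|], which controls each summand separately. *)
pose f X := p * #|` addfs X B| + q * #|` addfs X C|.
have [X [XZ X0 Xmin]] := exists_min_ratio f Z0; exists X; split=> //.
have hX D : f (addfs X D) * #|` X| <= f X * #|` addfs X D|.
  apply: petridis => [|W d|Y YX]; last exact: Xmin (fsubset_trans YX XZ).
    by rewrite /f ![addfs fset0 _]addfsC !addfs0 !muln0.
  rewrite /f addnACA -!mulnDr [X in _ <= X]addnACA -!mulnDr.
  by apply: leq_add; rewrite leq_mul2l card_addfs_submod orbT.
have hZ : f X * #|` Z| <= 2 * p * q * #|` X|.
  apply: leq_trans (Xmin Z (fsubset_refl Z)) _.
  by rewrite /f -/p -/q [q * p]mulnC addnn -mul2n mulnA.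
have x0 : 0 < #|` X| by rewrite cardfs_gt0.
have h1 : #|` addfs X C| * #|` Z| <= 2 * p * #|` X|.
  rewrite -(leq_pmul2l q0); apply: (@leq_trans (f X * #|` Z|)).
    by rewrite mulnA leq_mul2r leq_addl orbT.
  by apply: leq_trans hZ _; rewrite -!mulnA (mulnCA q) (mulnCA q).
(* Petridis's inequality with [D := C], keeping only the [B]-term of [f (X + C)]. *)
have h2 : #|` addfs (addfs X C) B| * #|` Z| <= 2 * q * #|` addfs X C|.
  rewrite -(leq_pmul2l p0) -(leq_pmul2r x0).
  apply: (@leq_trans (f (addfs X C) * #|` X| * #|` Z|)).
    rewrite mulnA mulnAC leq_mul2r; apply/orP; right.
    by rewrite leq_mul2r leq_addr orbT.
  apply: (@leq_trans (f X * #|` addfs X C| * #|` Z|)).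
    by rewrite leq_mul2r hX orbT.
  rewrite mulnAC; apply: (@leq_trans (2 * p * q * #|` X| * #|` addfs X C|)).
    by rewrite leq_mul2r hZ orbT.
  by rewrite leq_eqVlt; apply/orP; left; apply/eqP; ring.
rewrite expnS expn1 mulnA.
apply: leq_trans (leq_mul h2 (leqnn _)) _; rewrite -mulnA.
apply: leq_trans (leq_mul (leqnn _) h1) _.
by rewrite leq_eqVlt; apply/orP; left; apply/eqP; ring.
Qed.

Lemma card_fset_sep (T : choiceType) (E : {fset T}) (P : pred T) :
  #|` [fset x in E | P x]| = \sum_(x <- E) P x.
Proof.
rewrite card_fset_sum1 big_fset big_mkcond /=.
by apply: eq_bigr => x _; case: (P x).
Qed.

Definition subfs A B : {fset V} := [fset (a - b)%R | a in A, b in B].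

(** Fix for each [z] in [U - U] a representation [z = s - t]. Then [(x, z)] is sent injectively to
    [(x + s, x + t)]: the difference of the coordinates gives back [z], hence [s], hence [x]. *)
Lemma ruzsa_triangle X U : #|` X| * #|` subfs U U| <= #|` addfs X U| ^ 2.
Proof.
(* [g z] is the chosen [s]; the default [0] is never taken for [z] in [U - U]. *)
pose g z := head 0%R [seq s <- enum_fset U | (s - z)%R \in U].
have gP z : z \in subfs U U -> g z \in U /\ (g z - z)%R \in U.
  case/imfset2P => /= s sU [t tU zE]; rewrite /g.
  have : s \in [seq s <- enum_fset U | (s - z)%R \in U].
    by rewrite mem_filter sU zE subKr tU.
  case Eq: [seq _ <- _ | _] => [|s' r] // _ /=.
  have : s' \in s' :: r by rewrite mem_head.
  by rewrite -Eq mem_filter => /andP[].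
rewrite expnS expn1 -[X in _ <= X]card_fsetM.
apply: (leq_card_fset_inj (f := fun x z => (x + g z, x + (g z - z))%R)).
  by move=> x z xX /gP[gU gzU]; rewrite in_fsetM !mem_addfs.
move=> x z x' z' _ _ _ _ [e1 e2].
have ez : z = z' by apply: oppr_inj; apply: (addrI (x + g z)%R); rewrite {2}e1 -!addrA.
by move: e1; rewrite ez => /addIr.
Qed.

(** Plünnecke gives [X] inside [A] with [|X + 2A| <= 4 M^2 |X| / n^2]. Ruzsa's inequality with
    [U := 2A] then yields [|2A - 2A| <= 16 M^4 |X| / n^4], and [|X| <= n]. *)
Lemma card_diff_addfs A : A != fset0 ->
  #|` A| ^ 3 * #|` subfs (addfs A A) (addfs A A)| <= 16 * #|` addfs A A| ^ 4.
Proof.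
move=> A0; have [X [XA X0]] := plunnecke2 A A A0; rewrite addfsA.
have := ruzsa_triangle X (addfs A A); have := fsubset_leq_card XA.
have : 0 < #|` X| by rewrite cardfs_gt0.
have : 0 < #|` A| by rewrite cardfs_gt0.
move: #|` A| #|` X| #|` addfs A A| #|` addfs X _| #|` subfs _ _| => n x M y z.
move=> n0 x0 xn h1 h2; rewrite -(leq_pmul2l x0) -(leq_pmul2l n0).
apply: (@leq_trans ((x * z) * n ^ 4)).
  by rewrite leq_eqVlt; apply/orP; left; apply/eqP; rewrite !expnS; ring.
apply: (@leq_trans (y ^ 2 * n ^ 4)); first by rewrite leq_mul2r h1 orbT.
have -> : y ^ 2 * n ^ 4 = (y * n ^ 2) ^ 2 by rewrite !expnS; ring.
apply: (@leq_trans ((4 * M * M * x) ^ 2)); first by rewrite leq_exp2r.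
have -> : (4 * M * M * x) ^ 2 = x * (16 * M ^ 4) * x by rewrite !expnS; ring.
by rewrite mulnC leq_mul2r xn orbT.
Qed.

(** A most popular sum [t]: the [|U| |S|] pairs are spread over [U + S], and the fibre over [t] is
    the part of [U] lying in [t - S]. *)
Lemma covering_step U S : U != fset0 -> S != fset0 ->
  exists t, #|` U| * #|` S| <= #|` addfs U S| * #|` [fset u in U | (t - u)%R \in S]|.
Proof.
case/fset0Pn => u0 u0U; case/fset0Pn => s0 s0S.
have US0 : 0 < size (addfs U S).
  by rewrite cardfs_gt0; apply/fset0Pn; exists (u0 + s0)%R; apply: mem_addfs.
have [t _ ht] := exists_ge_average
  (fun t => #|` [fset u in U | (t - u)%R \in S]|) US0.
exists t; apply: leq_trans ht.
under eq_bigr => z _ do rewrite card_fset_sep.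
rewrite exchange_big /= card_fset_sum1 big_distrl /= !big_seq.
apply: leq_sum => u uU; rewrite mul1n -card_fset_sep -(card_shiftfs u S).
apply/fsubset_leq_card/fsubsetP => z; rewrite mem_shiftfs !inE /= => zS.
by rewrite zS andbT -[z](subrK u) addrC mem_addfs.
Qed.

(** Greedy covering by translates [t - S]. As long as more than [1/8] of [U] is uncovered, a popular
    [t] covers at least [N |U| / (8M)] new elements. The fraction [1/8] is chosen so that four such
    coverings jointly miss at most half. *)
Lemma covering U S M N : 0 < N -> N <= #|` S| -> N <= M -> #|` addfs U S| <= M ->
  exists T, #|` T| * N <= 9 * M /\
    8 * #|` [fset u in U | ~~ has (fun t => (t - u)%R \in S) T]| <= #|` U|.
Proof.
move=> N0 NS NM USM.
pose unc T := [fset u in U | ~~ has (fun t => (t - u)%R \in S) T].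
have S0 : S != fset0 by rewrite -cardfs_gt0; apply: leq_trans NS.
suff H k : exists T, #|` T| <= k /\ (8 * #|` unc T| <= #|` U| \/
    k * N * #|` U| + 8 * M * #|` unc T| <= 8 * M * #|` U|).
  (* One step beyond [8M / N] makes the second alternative impossible for nonempty [U]; the extra
     step costs [N <= M], which turns [8M] into [9M]. *)
  have [T [Tk hT]] := H (8 * M %/ N).+1; exists T; split.
    apply: (@leq_trans ((8 * M %/ N).+1 * N)); first by rewrite leq_mul2r Tk orbT.
    by rewrite mulSn (mulnDl 1 8) mul1n leq_add // leq_trunc_div.
  case: hT => // hT; have : (8 * M %/ N).+1 * N * #|` U| <= 8 * M * #|` U|.
    exact: leq_trans (leq_addr _ _) hT.
  have [U0 _|U0] := posnP #|` U|.
    rewrite U0 leqn0 muln_eq0 /= -leqn0 -U0.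
    by apply/fsubset_leq_card/fsubsetP => u; rewrite !inE => /andP[].
  by rewrite leq_pmul2r // leqNgt -ltn_divLR // ltnS leqnn.
elim: k => [|k [T [Tk hT]]].
  exists fset0; rewrite cardfs0; split=> //; right.
  rewrite mul0n mul0n add0n leq_mul2l; apply/orP; right.
  by apply/fsubset_leq_card/fsubsetP => u; rewrite !inE => /andP[].
have [le8|lt8] := leqP (8 * #|` unc T|) #|` U|.
  by exists T; split; [exact: leqW | left].
case: hT => [|hT]; first by rewrite leqNgt lt8.
have unc0 : unc T != fset0.
  by apply: contraTneq lt8 => ->; rewrite cardfs0 muln0 ltn0.
have [t ht] := covering_step unc0 S0; exists (t |` T); split.
  by apply: leq_trans (leq_card_fsetU _ _) _; rewrite cardfs1 add1n ltnS.
right; have hU : #|` unc (t |` T)| + #|` [fset u in unc T | (t - u)%R \in S]| = #|` unc T|.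
  have hasU P : has P (t |` T) = P t || has P T.
    apply/hasP/orP => [[x]|].
      rewrite in_fset1U => /orP[/eqP->|xT]; first by left.
      by right; apply/hasP; exists x.
    case=> [Pt|/hasP[x xT Px]]; first by exists t => //; rewrite in_fset1U eqxx.
    by exists x => //; rewrite in_fset1U xT orbT.
  rewrite addnC -[RHS](cardfsID [fset u in unc T | (t - u)%R \in S]); congr (_ + _).
    congr #|` _|; apply/fsetP => u; rewrite !inE /=.
    by case: (_ \in U); case: (has _ _).
  congr #|` _|; apply/fsetP => u; rewrite !inE /= hasU.
  by case: (_ \in U); case: (has _ _); case: (_ \in S).
rewrite -hU in hT; apply: leq_trans hT.
rewrite mulSn mulnDl [8 * M * (_ + _)]mulnDr -!addnA addnCA leq_add2l addnC leq_add2l.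
apply: (@leq_trans (8 * (#|` unc T| * #|` S|))).
  by rewrite mulnA mulnC leq_mul // ltnW.
rewrite -mulnA leq_mul2l /=; apply: leq_trans ht _; rewrite leq_mul2r.
apply/orP; right; apply: leq_trans USM; apply/fsubset_leq_card/addfsS => //.
by apply/fsubsetP => u; rewrite !inE => /andP[].
Qed.

End Additive.

(** Here [ta], ..., [td] are sizes of covering sets, [n1] and [n2] those of [A1] and [A2], and [e]
    is [|2A - 2A|]. Then [n1^3 <= 8 n2^3 <= 32 M K], [K N^4 <= (9M)^4 e] and [n^3 e <= 16 M^4]
    multiply to the claim, with [512 = 32 * 16]. *)
Lemma level_arith (ta tb tc td n1 n2 n M K N e : nat) :
  ta * N <= 9 * M -> tb * N <= 9 * M -> tc * N <= 9 * M -> td * N <= 9 * M ->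
  n1 <= 2 * n2 -> n2 ^ 3 <= 4 * M * K -> K <= tc * td * (ta * tb) * e ->
  n ^ 3 * e <= 16 * M ^ 4 ->
  n ^ 3 * (n1 ^ 3 * N ^ 4) <= 512 * 9 ^ 4 * M ^ 9.
Proof.
move=> ha hb hc hd h12 h2 hK he.
have hN : tc * td * (ta * tb) * N ^ 4 <= (9 * M) ^ 4.
  have -> : tc * td * (ta * tb) * N ^ 4 = (tc * N) * (td * N) * ((ta * N) * (tb * N)).
    by rewrite !expnS; ring.
  have -> : (9 * M) ^ 4 = (9 * M) * (9 * M) * ((9 * M) * (9 * M)).
    by move: (9 * M) => m; rewrite !expnS; ring.
  by do 2![apply: leq_mul => //].
have h1 : n1 ^ 3 <= 8 * (4 * M * K).
  apply: (@leq_trans ((2 * n2) ^ 3)); first by rewrite leq_exp2r.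
  by rewrite expnMn leq_mul2l h2 orbT.
have h3 : n ^ 3 * K * N ^ 4 <= (16 * M ^ 4) * (9 * M) ^ 4.
  apply: (@leq_trans (n ^ 3 * (tc * td * (ta * tb) * e) * N ^ 4)).
    by rewrite leq_mul2r leq_mul2l hK !orbT.
  have -> : n ^ 3 * (tc * td * (ta * tb) * e) * N ^ 4
      = (n ^ 3 * e) * (tc * td * (ta * tb) * N ^ 4) by ring.
  exact: leq_mul.
apply: (@leq_trans (n ^ 3 * (8 * (4 * M * K) * N ^ 4))).
  by rewrite leq_mul2l leq_mul2r h1 !orbT.
have -> : n ^ 3 * (8 * (4 * M * K) * N ^ 4) = 32 * M * (n ^ 3 * K * N ^ 4) by ring.
apply: leq_trans (leq_mul (leqnn _) h3) _.
rewrite expnMn; move: (9 ^ 4) => u.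
by rewrite leq_eqVlt; apply/orP; left; apply/eqP; rewrite !expnS; ring.
Qed.

(** * Dilates in an integral domain: pivots, coverings and popular levels *)

Section Domain.
Variable D : idomainType.
Implicit Types (A B T : {fset D}) (a b c d x y t : D).

Definition dilate c A : {fset D} := [fset (c * a)%R | a in A].

Lemma dilateP c A z : reflect (exists2 a, a \in A & z = (c * a)%R) (z \in dilate c A).
Proof. exact: imfsetP. Qed.

Lemma mem_dilate c A a : a \in A -> (c * a)%R \in dilate c A.
Proof. by move=> aA; apply/dilateP; exists a. Qed.

Lemma card_dilate c A : c != 0%R -> #|` dilate c A| = #|` A|.
Proof. by move=> c0; rewrite card_imfset //; apply: mulfI. Qed.

Lemma leq_card_dilate c A : #|` dilate c A| <= #|` A|.
Proof. exact: leq_imfset_card. Qed.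

Lemma dilateD c A B : addfs (dilate c A) (dilate c B) = dilate c (addfs A B).
Proof.
apply/fsetP => z; apply/addfsP/dilateP.
  case=> _ /dilateP[a aA ->] [_ /dilateP[b bB ->] ->].
  by exists (a + b)%R; [exact: mem_addfs | rewrite mulrDr].
case=> _ /addfsP[a aA [b bB ->]] ->; exists (c * a)%R; first exact: mem_dilate.
by exists (c * b)%R; [exact: mem_dilate | rewrite mulrDr].
Qed.

Lemma natr_inj_char0 (k l : nat) : char_zero D -> (k%:R = l%:R :> D)%R -> k = l.
Proof.
move=> /pcharf0P D0.
wlog le_kl : k l / k <= l => [H e|].
  by have [|/ltnW] := leqP k l => h; [|symmetry]; apply: H.
move/eqP; rewrite eq_sym -subr_eq0 -natrB // D0 subn_eq0 => le_lk.
by apply/eqP; rewrite eqn_leq le_kl.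
Qed.

(* [k] is a quotient of differences of [A] for [k = 0] but, [D] being of
   characteristic zero, not for all [k]; take the last [k] before a failure. *)
Lemma exists_pivot A : char_zero D -> 1 < #|` A| ->
  exists a b c d, [/\ a \in A, b \in A, c \in A & d \in A] /\ c != d /\
    forall x y x' y', x \in A -> y \in A -> x' \in A -> y' \in A ->
      ((c - d) * x + ((a - b) + (c - d)) * y
        = (c - d) * x' + ((a - b) + (c - d)) * y')%R -> x = x' /\ y = y'.
Proof.
move=> D0 A1; pose P := (A `*` A) `*` (A `*` A).
pose quo (k : nat) (q : (D * D) * (D * D)) :=
  (q.2.1 != q.2.2) && (q.1.1 - q.1.2 == k%:R * (q.2.1 - q.2.2))%R.
have inP q : q \in P -> [/\ q.1.1 \in A, q.1.2 \in A, q.2.1 \in A & q.2.2 \in A].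
  by rewrite !in_fsetM => /andP[/andP[-> ->] /andP[-> ->]].
have [a0 [b0 [a0A b0A ab0]]] : exists a b, [/\ a \in A, b \in A & a != b].
  have [a aA] : exists a, a \in A by apply/fset0Pn; rewrite -cardfs_gt0 ltnW.
  have [b] : exists b, b \in A `\ a.
    apply/fset0Pn; rewrite -cardfs_gt0.
    by move: A1; rewrite (cardfsD1 a) aA.
  by rewrite in_fsetD1 eq_sym => /andP[ab bA]; exists a, b.
(* Pigeonhole: a quadruple in [P] determines its quotient [k], by cancelling a nonzero difference
   and characteristic zero, so [size P + 1] values of [k] cannot all occur. *)
have [k nk] : exists k, ~~ has (quo k) P.
  have [/allP Pall|/allPn[k _]] := boolP (all (fun k => has (quo k) P) (iota 0 (size P).+1));
    last by exists k.
  pose q0 := ((a0, a0), (a0, a0)); pose f k := nth q0 P (find (quo k) P).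
  have fP k : k \in iota 0 (size P).+1 -> f k \in P /\ quo k (f k).
    by move/Pall => h; split; [rewrite mem_nth // -has_find | exact: nth_find].
  have : size [seq f k | k <- iota 0 (size P).+1] <= size P.
    apply: uniq_leq_size => [|_ /mapP[k /fP[fkP _] ->]] //.
    rewrite map_inj_in_uniq ?iota_uniq // => k l /fP[_ qk] /fP[_ ql] e.
    move: qk ql; rewrite -e => /andP[cd /eqP ek] /andP[_ /eqP el].
    by apply: natr_inj_char0 => //; apply: (mulIf (x := ((f k).2.1 - (f k).2.2)%R));
      rewrite ?subr_eq0 // -ek.
  by rewrite size_map size_iota ltnn.
have exk : exists k, ~~ has (quo k) P by exists k.
(* The least failing [k] is not [0], so it is [m.+1] and [a - b = m (c - d)] for some quadruple. A
   collision with [y != y'] would give [x' - x = m.+1 (y - y')], making [m.+1] a quotient. *)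
case: (ex_minnP exk) => -[|m] hm mmin {k nk exk}.
  case/hasP: hm; exists ((a0, a0), (a0, b0)); first by rewrite !in_fsetM /= a0A b0A.
  by rewrite /quo /= ab0 subrr mul0r eqxx.
have : has (quo m) P by apply: contraT => /mmin; rewrite ltnn.
case/hasP => -[[a b] [c d]] /inP[/= aA bA cA dA] /andP[/= cd /eqP abE].
exists a, b, c, d; split=> //; split=> // x y x' y' xA yA x'A y'A.
have -> : (a - b + (c - d) = (c - d) * m.+1%:R)%R by rewrite abE -natr1; ring.
rewrite -!mulrA -!mulrDr => /mulfI; rewrite subr_eq0 => /(_ cd) e.
have eyy : y = y'.
  apply/eqP; apply: contraNT hm => yy'; apply/hasP.
  exists ((x', x), (y, y')); first by rewrite !in_fsetM /= xA yA x'A y'A.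
  rewrite /quo /= yy' mulrBr; apply/eqP; apply: (addrI (x + m.+1%:R * y')%R).
  transitivity (x' + m.+1%:R * y')%R; first by ring.
  by rewrite -e; ring.
by move: e; rewrite eyy => /addIr.
Qed.

(** The covering lemma for [U := xA1] and [S], the intersection of [xA] and [bA]: their sum lies in
    [x(A + A)]. Multiplication by [x] is injective, so the uncovered part can be counted in [A1]. *)
Lemma card_dilate_cover A A1 b x (N : nat) : 0 < N -> x != 0%R -> b \in A ->
    A1 `<=` A -> N <= #|` dilate x A `&` dilate b A| ->
  exists T, #|` T| * N <= 9 * #|` addfs A A| /\
    8 * #|` [fset y in A1 | ~~ has (fun t => (t - x * y)%R \in dilate b A) T]|
      <= #|` A1|.
Proof.
move=> N0 x0 bA A1A hN; set S := dilate x A `&` dilate b A in hN.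
have A0 : A != fset0 by apply/fset0Pn; exists b.
have NM : N <= #|` addfs A A|.
  apply: leq_trans (card_addfs_l A A0); apply: leq_trans (leq_card_dilate b A).
  by apply: leq_trans hN _; apply/fsubset_leq_card/fsubsetIr.
have USM : #|` addfs (dilate x A1) S| <= #|` addfs A A|.
  apply: leq_trans (leq_card_dilate x _); rewrite -dilateD.
  apply/fsubset_leq_card/addfsS; last exact: fsubsetIl.
  by apply/fsubsetP => _ /dilateP[a /(fsubsetP A1A) aA ->]; apply: mem_dilate.
have [T [TN hT]] := covering N0 hN NM USM; exists T; split=> //.
apply: leq_trans (leq_card_dilate x A1); apply: leq_trans hT; rewrite leq_mul2l /=.
rewrite -(card_dilate _ x0); apply/fsubset_leq_card/fsubsetP => _ /dilateP[y + ->].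
rewrite !inE /= => /andP[yA1 hy]; rewrite mem_dilate //=.
by apply: contra hy => /hasP[t tT]; rewrite inE => /andP[_ tS]; apply/hasP; exists t.
Qed.

Lemma half_of_eighths n m1 m2 m3 m4 m :
  8 * m1 <= n -> 8 * m2 <= n -> 8 * m3 <= n -> 8 * m4 <= n ->
  n <= m1 + m2 + m3 + m4 + m -> n <= 2 * m.
Proof. lia. Qed.

Lemma dilate_level_bound A b (N : nat) : char_zero D -> 0%R \notin A -> b \in A ->
  #|` A| ^ 3 * (#|` [fset a in A | N <= #|` dilate a A `&` dilate b A|]| ^ 3 * N ^ 4)
    <= 512 * 9 ^ 4 * #|` addfs A A| ^ 9.
Proof.
move=> D0 A0 bA; set A1 := [fset a in A | _].
have An0 : A != fset0 by apply/fset0Pn; exists b.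
have A1A : A1 `<=` A by apply/fsubsetP => x; rewrite !inE => /andP[].
have nM : #|` A| <= #|` addfs A A| := card_addfs_l A An0.
have M0 : 0 < #|` addfs A A| by apply: leq_trans nM; rewrite cardfs_gt0.
have [->|N0] := posnP N; first by rewrite exp0n // !muln0.
have hA1 x : x \in A1 -> x != 0%R /\ N <= #|` dilate x A `&` dilate b A|.
  rewrite !inE /= => /andP[xA ->]; split=> //.
  by apply: contraNneq A0 => <-.
clearbody A1.
(* A pivot needs two elements of [A1]. With at most one, [|A| <= M] and [N <= M] already give
   [M^7 <= M^9]. *)
have [le1|lt1] := leqP #|` A1| 1.
  have [/cardfs0_eq ->|] := posnP #|` A1|; first by rewrite cardfs0 !exp0n // muln0.
  rewrite cardfs_gt0 => /fset0Pn[x /hA1[x0 hx]].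
  have NM : N <= #|` addfs A A|.
    apply: leq_trans nM; apply: leq_trans (leq_card_dilate b A).
    by apply: leq_trans hx _; apply/fsubset_leq_card/fsubsetIr.
  apply: (@leq_trans (#|` addfs A A| ^ 3 * (1 ^ 3 * #|` addfs A A| ^ 4))).
    by rewrite leq_mul ?leq_mul ?leq_exp2r.
  rewrite exp1n mul1n -expnD; apply: (@leq_trans (1 * #|` addfs A A| ^ 9)).
    by rewrite mul1n leq_pexp2l.
  by rewrite leq_mul2r muln_gt0 expn_gt0 orbT.
have [a [b' [c [d [[aA bA' cA dA] [cd inj]]]]]] := exists_pivot D0 lt1.
have cover x (xA1 : x \in A1) :=
  card_dilate_cover N0 (hA1 x xA1).1 bA A1A (hA1 x xA1).2.
have [Ta [Na ha]] := cover a aA; have [Tb [Nb hb]] := cover b' bA'.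
have [Tc [Nc hc]] := cover c cA; have [Td [Nd hd]] := cover d dA.
pose cov x T y := has (fun t => (t - x * y)%R \in dilate b A) T.
(* The [y] whose dilates by [a], [b'], [c] and [d] are all covered; each covering loses at most an
   eighth of [A1]. *)
pose A2 := [fset y in A1 | [&& cov a Ta y, cov b' Tb y, cov c Tc y & cov d Td y]].
have A12 : #|` A1| <= 2 * #|` A2|.
  have : A1 `<=` [fset y in A1 | ~~ cov a Ta y] `|` [fset y in A1 | ~~ cov b' Tb y]
     `|` [fset y in A1 | ~~ cov c Tc y] `|` [fset y in A1 | ~~ cov d Td y] `|` A2.
    apply/fsubsetP => y yA1; rewrite !inE /= yA1 /=.
    by case: (cov a _ _); case: (cov b' _ _); case: (cov c _ _); case: (cov d _ _).
  move/fsubset_leq_card => h.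
  have h4 (B1 B2 B3 B4 B5 : {fset D}) :
      #|` B1 `|` B2 `|` B3 `|` B4 `|` B5|
        <= #|` B1| + #|` B2| + #|` B3| + #|` B4| + #|` B5|.
    by do 4! [apply: leq_trans (leq_card_fsetU _ _) _; rewrite leq_add2r].
  exact: half_of_eighths ha hb hc hd (leq_trans h (h4 _ _ _ _ _)).
have A21 x : x \in A2 -> x \in A1.
  by rewrite !inE => /andP[].
have A2A x : x \in A2 -> x \in A by move/A21/(fsubsetP A1A).
have cd0 : (c - d != 0)%R by rewrite subr_eq0.
set Z := dilate (c - d)%R A2; set C := dilate (a - b')%R A2.
have Z0 : Z != fset0.
  rewrite -cardfs_gt0 card_dilate // lt0n; apply: contraTneq lt1 => A20.
  by move: A12; rewrite A20 leqn0 => /eqP->.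
set K := #|` addfs Z C|.
(* Each of [cx], [dx], [ay], [b'y] is a covering element minus an element of [bA]. Their signed sum
   [cx - dx + ay - b'y] is thus fixed by four covering elements and one element of [2A - 2A]. *)
have hK : K <= #|` (Tc `*` Td) `*` (Ta `*` Tb)| * #|` subfs (addfs A A) (addfs A A)|.
  apply: (leq_card_fset_surj
    (f := fun q w => ((q.1.1 - q.1.2) + (q.2.1 - q.2.2) - b * w)%R)).
  move=> _ /addfsP[_ /dilateP[x xA2 ->] [_ /dilateP[y yA2 ->] ->]].
  move: xA2; rewrite !inE /= => /andP[_ /and4P[_ _ /hasP[tc tcT] + /hasP[td tdT]]].
  move=> /dilateP[sc scA ec] /dilateP[sd sdA ed].
  move: yA2; rewrite !inE /= => /andP[_ /and4P[/hasP[ta taT] + /hasP[tb tbT] + _ _]].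
  move=> /dilateP[sa saA ea] /dilateP[sb sbA eb].
  exists ((tc, td), (ta, tb)); first by rewrite !in_fsetM /= tcT tdT taT tbT.
  exists ((sc + sa) - (sd + sb))%R; first by apply: in_imfset2; apply: mem_addfs.
  rewrite !mulrBl -(subKr tc (c * x)%R) ec -(subKr td (d * x)%R) ed.
  rewrite -(subKr ta (a * y)%R) ea -(subKr tb (b' * y)%R) eb /=; ring.
(* The second summand is [Z] itself: [Z + Z] is a dilate of [A2 + A2], of size at most [M]. *)
have [X [XZ X0 hX]] := plunnecke2 (dilate (c - d)%R A2) C Z0.
have x0 : 0 < #|` X| by rewrite cardfs_gt0.
(* Elements of [X] have the form [(c - d) u], so this is the injective pivot map in [(u, y)]. *)
have hinj : #|` X| * #|` A2| <= #|` addfs (addfs X C) (dilate (c - d)%R A2)|.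
  apply: (leq_card_fset_inj (f := fun x y => (x + (a - b') * y + (c - d) * y)%R)).
    by move=> x y xX yA2; rewrite !mem_addfs ?mem_dilate.
  move=> x y x' y' /(fsubsetP XZ)/dilateP[u /A21 uA ->] /A21 yA.
  move=> /(fsubsetP XZ)/dilateP[u' /A21 uA' ->] /A21 yA' e.
  have [|-> ->] // := inj u y u' y' uA yA uA' yA' _.
  by rewrite !(mulrDl (a - b')%R) !addrA.
have hZB : #|` addfs Z (dilate (c - d)%R A2)| <= #|` addfs A A|.
  rewrite /Z dilateD; apply: leq_trans (leq_card_dilate _ _) _.
  by apply/fsubset_leq_card/addfsS; apply/fsubsetP.
have h3 : #|` A2| ^ 3 <= 4 * #|` addfs A A| * K.
  rewrite -(leq_pmul2l x0) expnS mulnA -(card_dilate A2 cd0) -/Z.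
  apply: (@leq_trans (#|` addfs (addfs X C) (dilate (c - d) A2)| * #|` Z| ^ 2)).
    by rewrite leq_mul2r card_dilate // hinj orbT.
  apply: leq_trans hX _; rewrite [X in _ <= X]mulnC leq_mul2r; apply/orP; right.
  by rewrite leq_mul2r leq_mul2l hZB !orbT.
have := card_diff_addfs An0; move: hK; rewrite !card_fsetM -/K.
move: Na Nb Nc Nd A12 h3.
move: #|` Ta| #|` Tb| #|` Tc| #|` Td| #|` A1| #|` A2| #|` A| #|` addfs A A| K => ta tb tc td.
move: #|` subfs _ _| => e; clear => n1 n2 n M L.
exact: level_arith.
Qed.

(** * Multiplicative energy and the fourteenth-power inequality *)

Definition mulfs A B : {fset D} := [fset (a * b)%R | a in A, b in B].

(** Let [r p] count the [a] in [A] with [p] in [aA]. Its sum over [AA] is [n^2], and its sum of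
    squares is the sum over all pairs [a], [c] of the size of the intersection of [aA] and [cA].
    Cauchy-Schwarz bounds the latter below by [n^4 / |AA|], and [b] is a best choice of [c]. *)
Lemma exists_popular_dilate A : A != fset0 -> 0%R \notin A ->
  exists2 b, b \in A &
    #|` A| ^ 3 <= #|` mulfs A A| * \sum_(a <- A) #|` dilate a A `&` dilate b A|.
Proof.
move=> A0 nA0; have n0 : 0 < #|` A| by rewrite cardfs_gt0.
have [b bA hb] := exists_ge_average
  (fun b => \sum_(a <- A) #|` dilate a A `&` dilate b A|) n0.
exists b => //; rewrite -(leq_pmul2l n0) mulnCA.
apply: leq_trans (leq_mul (leqnn #|` mulfs A A|) hb).
pose r p := \sum_(a <- A) (p \in dilate a A).
have dA a : a \in A -> dilate a A `<=` mulfs A A.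
  by move=> aA; apply/fsubsetP => _ /dilateP[x xA ->]; apply: in_imfset2.
have card_sub (E : {fset D}) : E `<=` mulfs A A ->
    #|` E| = \sum_(p <- mulfs A A) (p \in E).
  move=> EM; rewrite -card_fset_sep; congr #|` _|; apply/fsetP => p.
  rewrite !inE /=; case pE: (p \in E); rewrite ?andbF // andbT.
  by symmetry; apply: (fsubsetP EM).
have sum_r : \sum_(p <- mulfs A A) r p = #|` A| ^ 2.
  transitivity (\sum_(a <- A) #|` A|); last first.
    by rewrite big_const_seq count_predT iter_addn_0.
  rewrite /r exchange_big /=; apply: eq_big_seq => a aA.
  rewrite -card_sub ?dA // card_dilate //.
  by apply: contraNneq nA0 => <-.
have sum_r2 : \sum_(p <- mulfs A A) r p ^ 2
    = \sum_(c <- A) \sum_(a <- A) #|` dilate a A `&` dilate c A|.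
  transitivity (\sum_(c <- A) \sum_(a <- A)
      \sum_(p <- mulfs A A) (p \in dilate a A `&` dilate c A)); last first.
    apply: eq_big_seq => c cA; apply: eq_bigr => a _; rewrite -card_sub //.
    exact: fsubset_trans (fsubsetIr _ _) (dA c cA).
  under [RHS]eq_bigr => c _ do rewrite exchange_big /=.
  rewrite [RHS]exchange_big /=; apply: eq_bigr => p _.
  rewrite /r expnS expn1 big_distrr /=; apply: eq_bigr => c _.
  rewrite big_distrl /=; apply: eq_bigr => a _.
  by rewrite in_fsetI mulnb.
rewrite -sum_r2; apply: leq_trans (sqr_sum_leq _ _).
by rewrite sum_r -expnM -expnS.
Qed.

(** The level bounds sum to [s^4 <= 256 C M^9 / n^2], while the popular dilate gives
    [n^12 <= (Q s)^4]. *)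
Lemma sum_product_fset A : char_zero D -> 0%R \notin A ->
  #|` A| ^ 14
    <= 256 * (512 * 9 ^ 4) * #|` addfs A A| ^ 9 * #|` mulfs A A| ^ 4.
Proof.
move=> D0 nA0; have [->|A0] := eqVneq A fset0; first by rewrite cardfs0 exp0n.
have [b bA hb] := exists_popular_dilate A0 nA0.
have n0 : 0 < #|` A| by rewrite cardfs_gt0.
have hlev N := dilate_level_bound N D0 nA0 bA.
move: hlev hb; move: (512 * 9 ^ 4) => C hlev.
set s := \sum_(a <- A) _ => hb.
have hs : s ^ 4 <= 256 * (C * #|` addfs A A| ^ 9 %/ #|` A| ^ 3) * #|` A|.
  by apply: sum_leq_of_levels => t; rewrite leq_divRL ?expn_gt0 ?n0 // mulnC.
move: hb hs n0; move: #|` addfs A A| #|` mulfs A A| => M Q.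
move: #|` A| s => n s hb hs n0; clear -hb hs n0.
have n4 : 0 < n ^ 4 by rewrite expn_gt0 n0.
(* The extra factor [n] turns the left side into [n^3 (n^3)^4], whose spare [n^3] undoes the integer
   division by [n^3]. *)
rewrite -(leq_pmul2l n0).
apply: (@leq_trans (n ^ 3 * (n ^ 3) ^ 4)).
  by rewrite -expnS -expnM -expnD.
apply: (@leq_trans (n ^ 3 * (Q * s) ^ 4)); first by rewrite leq_mul2l leq_exp2r // hb orbT.
rewrite expnMn.
apply: (@leq_trans (n ^ 3 * (Q ^ 4 * (256 * (C * M ^ 9 %/ n ^ 3) * n)))).
  by rewrite !leq_mul2l hs !orbT.
have := leq_trunc_div (C * M ^ 9) (n ^ 3).
move: (C * M ^ 9 %/ n ^ 3) => w hw.
have -> : n ^ 3 * (Q ^ 4 * (256 * w * n)) = (n * Q ^ 4 * 256) * (w * n ^ 3) by ring.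
have -> : n * (256 * C * M ^ 9 * Q ^ 4) = (n * Q ^ 4 * 256) * (C * M ^ 9) by ring.
by rewrite leq_mul2l hw orbT.
Qed.

(** The element [0] is discarded: [|A| <= |E| + 1 <= 2 |E|] when [E] is nonempty, which costs
    [2^14]. If [E] is empty then [|A| <= 1 <= m]. The exponent [13] is [9 + 4]. *)
Lemma sum_product_seq (A : seq D) : char_zero D -> 0 < card_seq A ->
  card_seq A ^ 14 <= 2 ^ 14 * (256 * (512 * 9 ^ 4))
    * maxn (card_seq (sumset A)) (card_seq (prodset A)) ^ 13.
Proof.
move=> D0 A0; set m := maxn _ _.
pose E := [fset x in A] `\ 0%R.
have EA x : x \in E -> x \in A by rewrite !inE /= => /andP[].
have cE : card_seq A <= #|` E| + 1.
  by rewrite /card_seq -card_fseq (cardfsD1 0%R) addnC leq_add2l leq_b1.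
have hM : #|` addfs E E| <= m.
  apply: (@leq_trans (card_seq (sumset A))); last exact: leq_maxl.
  rewrite /card_seq -card_fseq; apply/fsubset_leq_card/fsubsetP.
  move=> _ /addfsP[a /EA aA [b /EA bA ->]]; rewrite !inE /=.
  by apply/allpairsP; exists (a, b).
have hQ : #|` mulfs E E| <= m.
  apply: (@leq_trans (card_seq (prodset A))); last exact: leq_maxr.
  rewrite /card_seq -card_fseq; apply/fsubset_leq_card/fsubsetP.
  move=> _ /imfset2P[a /EA aA [b /EA bA ->]]; rewrite !inE /=.
  by apply/allpairsP; exists (a, b).
have E0 : 0%R \notin E by rewrite !inE eqxx.
have := sum_product_fset D0 E0; move: cE.
have : 0 < 256 * (512 * 9 ^ 4) by rewrite muln_gt0 muln_gt0 expn_gt0.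
move: (256 * _) => C C0 cE hE.
have m0 : 0 < m.
  apply: (@leq_trans (card_seq (sumset A))); last exact: leq_maxl.
  move: A0; rewrite /card_seq -!card_fseq !cardfs_gt0 => /fset0Pn[x].
  rewrite !inE /= => xA; apply/fset0Pn; exists (x + x)%R; rewrite !inE /=.
  by apply/allpairsP; exists (x, x).
have [e0|e0] := posnP #|` E|.
  rewrite e0 in cE; apply: (@leq_trans (1 ^ 14)); first by rewrite leq_exp2r.
  rewrite exp1n.
  by rewrite muln_gt0 [X in _ && X]expn_gt0 m0 andbT muln_gt0 C0 expn_gt0.
apply: (@leq_trans ((2 * #|` E|) ^ 14)).
  by rewrite leq_exp2r // (leq_trans cE) // mul2n -addnn leq_add2l.
rewrite expnMn -mulnA leq_mul2l; apply/orP; right; apply: leq_trans hE _.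
by rewrite -mulnA leq_mul2l (expnD m 9 4) leq_mul ?leq_exp2r ?orbT.
Qed.
End Domain.

(* Passage to real exponents *)
From Stdlib Require Import Reals Lra.

(** As [K >= 1], the hypothesis gives [n^14 <= (K m)^13]; take thirteenth roots. Lowering the
    exponent by [eps] is harmless because [n >= 1]. *)
Lemma Rpower_bound_of_pow (n m K : nat) (eps : R) : (0 < eps)%R ->
  0 < n -> 0 < K -> expn n 14 <= K * expn m 13 ->
  (/ INR K * Rpower (INR n) (14 / 13 - eps) <= INR m)%R.
Proof.
move=> eps0 n0 K0 h.
have INR_exp a k : INR (expn a k) = (INR a ^ k)%R.
  by elim: k => [//|k IH]; rewrite expnS mult_INR IH.
have INR_pos a : 0 < a -> (0 < INR a)%R by move=> a0; apply/lt_0_INR/ssrnat.ltP.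
have m0 : 0 < m.
  by rewrite lt0n; apply: contraTneq h => ->; rewrite exp0n // muln0 -ltnNge expn_gt0 n0.
have hn := INR_pos _ n0; have hm := INR_pos _ m0; have hK := INR_pos _ K0.
have n1 : (1 <= INR n)%R by apply: (le_INR 1); apply/ssrnat.leP.
have K1 : (1 <= INR K)%R by apply: (le_INR 1); apply/ssrnat.leP.
have hR : (INR n ^ 14 <= (INR K * INR m) ^ 13)%R.
  apply: (Rle_trans _ (INR K * INR m ^ 13)).
    by rewrite -!INR_exp -mult_INR; apply/le_INR/ssrnat.leP.
  rewrite Rpow_mult_distr; apply: Rmult_le_compat_r; first by apply: pow_le; lra.
  by rewrite -{1}[INR K]pow_1; apply: Rle_pow => //; apply/ssrnat.leP.
have hKm : (0 < INR K * INR m)%R by apply: Rmult_lt_0_compat.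
have hp : (Rpower (INR n) (14 / 13 - eps) <= INR K * INR m)%R.
  apply: (Rle_trans _ (Rpower (INR n) (14 / 13))); first by apply: Rle_Rpower; lra.
  have -> : (14 / 13 = INR 14 * / 13)%R by rewrite /=; lra.
  rewrite -Rpower_mult Rpower_pow //.
  have -> : (INR K * INR m = Rpower ((INR K * INR m) ^ 13) (/ 13))%R.
    rewrite -Rpower_pow // Rpower_mult.
    have -> : (INR 13 * / 13 = 1)%R by rewrite /=; lra.
    by rewrite Rpower_1.
  by apply: Rle_Rpower_l; [lra | split; [apply: pow_lt | ]].
apply: (Rmult_le_reg_l (INR K)) => //.
by rewrite -Rmult_assoc Rinv_r ?Rmult_1_l //; lra.
Qed.

Theorem mainTheorem5 :
  forall eps : R, (0 < eps)%R ->
  exists c : R, (0 < c)%R /\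
    forall (D : idomainType) (A : seq D),
      char_zero D ->
      (0 < card_seq A)%N ->
      (c * Rpower (INR (card_seq A)) (14 / 13 - eps)
        <= INR (maxn (card_seq (sumset A)) (card_seq (prodset A))))%R.
Proof.
move=> eps eps0.
have [K K0 hK] : exists2 K, 0 < K & forall (D : idomainType) (A : seq D),
    char_zero D -> 0 < card_seq A -> expn (card_seq A) 14
      <= K * expn (maxn (card_seq (sumset A)) (card_seq (prodset A))) 13.
  (* The factors come from discarding [0], from summing over levels, and from the bound at one
     level. *)
  exists (expn 2 14 * (256 * (512 * expn 9 4))); last exact: sum_product_seq.
  by rewrite muln_gt0 expn_gt0 muln_gt0 muln_gt0 expn_gt0.
exists (/ INR K)%R; split; first by apply/Rinv_0_lt_compat/lt_0_INR/ssrnat.ltP.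
by move=> D A D0 A0; apply: Rpower_bound_of_pow => //; apply: hK.
Qed.
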